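(* Let $n\ge 9$ be an odd integer and let $I=\{2,3,\ldots,\frac{n-1}{2}-2\}$. Then the $2$-section of $3\text{-}AUQI(n,2)$ is the merged Johnson graph $J(n,\frac{n-1}{2})_I$, that is, $$[3\text{-}AUQI(n,2)]_2=J\big(n,\tfrac{n-1}{2}\big)_I ,$$ where each vertex of $3\text{-}AUQI(n,2)$, viewed as a partition of $[n]$ into two parts, is identified with its part of size $\frac{n-1}{2}$.
   Context: $[n]=\{1,\dots,n\}$. Definition of $3\text{-}QI(n,2)$ (for $n\ge 8$): its vertices are all binary strings of length $n$ with entries in $\{0,1\}$ whose first entry is $0$ and in which each symbol occurs at least $4$ times; equivalently, the unordered partitions $\{A,\overline{A}\}$ of $[n]$ with $|A|,|\overline{A}|\ge 4$. Three vertices $v_1,v_2,v_3$ form a hyperedge if and only if for every $(g_1,g_2,g_3)\in\{0,1\}^3$ there is an index $j$ with $v_i[j]=g_i$ for $i=1,2,3$ (equivalently, all eight triple intersections of parts, one part from each partition, are non-empty). For $n$ odd, $3\text{-}AUQI(n,2)$ is the subhypergraph of $3\text{-}QI(n,2)$ induced on the vertices in which one symbol occurs $\frac{n-1}{2}$ times and the other $\frac{n+1}{2}$ times (its hyperedges are all hyperedges of $3\text{-}QI(n,2)$ contained in this vertex set). The $2$-section $[H]_2$ of a $3$-uniform hypergraph $H$ is the graph on the same vertex set in which two distinct vertices are adjacent iff they lie together in some hyperedge of $H$. The merged Johnson graph $J(n,m)_I$ has as vertices all $m$-subsets of $[n]$, with $M,M'$ adjacent iff $|M\cap M'|\in I$.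 *)

(* Defs.v *)
From mathcomp Require Import all_boot.

Set Implicit Arguments.
Unset Strict Implicit.
Unset Printing Implicit Defensive.

(* Graphs and hypergraphs live on a set of vertices inside an ambient finite  *)
(* type.  Loops are not excluded by the record, so that the merged Johnson    *)
(* graph is defined for an arbitrary set I of intersection sizes.             *)
Record graph (T : finType) := Graph {
  gvert : {set T};
  gadj : rel T;
  gadj_vert : forall u v, gadj u v -> u \in gvert;
  gadj_sym : symmetric gadj
}.

(* G and H are equal once each vertex u of G is identified with f u. *)
Definition equal_via (T T' : finType) (f : T -> T') (G : graph T)
    (H : graph T') : Prop :=
  [/\ {in gvert G &, injective f},
      f @: gvert G = gvert H
    & {in gvert G &, forall u v, gadj G u v = gadj H (f u) (f v)}].

Record hypergraph3 (T : finType) := Hypergraph3 {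
  hvert : {set T};
  hedge : {set {set T}};
  hedge_vert : forall e, e \in hedge -> e \subset hvert;
  hedge_card : forall e, e \in hedge -> #|e| = 3
}.

Section HypergraphOperations.
Variables (T : finType) (H : hypergraph3 T).

Section Induced.
Variable W : {set T}.

Definition induced_hedge := [set e in hedge H | e \subset hvert H :&: W].

Fact induced_hedge_vert e : e \in induced_hedge -> e \subset hvert H :&: W.
Proof. by rewrite inE => /andP[]. Qed.

Fact induced_hedge_card e : e \in induced_hedge -> #|e| = 3.
Proof. by rewrite inE => /andP[/hedge_card]. Qed.

Definition induced : hypergraph3 T :=
  Hypergraph3 induced_hedge_vert induced_hedge_card.
End Induced.

Definition two_section_adj : rel T := fun u v =>
  (u != v) && [exists e in hedge H, (u \in e) && (v \in e)].

Fact two_section_adj_vert u v : two_section_adj u v -> u \in hvert H.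
Proof.
by case/andP=> _ /exists_inP[e /hedge_vert/subsetP sub_e /andP[/sub_e]].
Qed.

Fact two_section_adj_sym : symmetric two_section_adj.
Proof.
move=> u v; rewrite /two_section_adj eq_sym; congr (_ && _).
by apply: eq_existsb => e; rewrite [(u \in e) && _]andbC.
Qed.

Definition two_section : graph T :=
  Graph two_section_adj_vert two_section_adj_sym.
End HypergraphOperations.

Section MergedJohnson.
Variables (n m : nat) (I : pred nat).

Definition merged_johnson_adj : rel {set 'I_n} := fun M M' =>
  [&& #|M| == m, #|M'| == m & #|M :&: M'| \in I].

Fact merged_johnson_adj_vert M M' :
  merged_johnson_adj M M' -> M \in [set M : {set 'I_n} | #|M| == m].
Proof. by case/and3P; rewrite inE. Qed.

Fact merged_johnson_adj_sym : symmetric merged_johnson_adj.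
Proof. by move=> M M'; rewrite /merged_johnson_adj setIC andbCA. Qed.

Definition merged_johnson : graph {set 'I_n} :=
  Graph merged_johnson_adj_vert merged_johnson_adj_sym.
End MergedJohnson.

(* A binary string is a boolean tuple, with false for 0 and true for 1; its   *)
(* positions 1, ..., n are the elements 0, ..., n - 1 of 'I_n.                *)
Section QualitativeIndependence.
Variable n : nat.
Implicit Types v : n.-tuple bool.

Definition QI_vert : {set n.-tuple bool} :=
  [set v : n.-tuple bool
     | (head false v == false) && [forall b : bool, 4 <= count_mem b v]].

Definition qualitatively_independent v1 v2 v3 : bool :=
  [forall g1 : bool, forall g2 : bool, forall g3 : bool, exists j : 'I_n,
     [&& tnth v1 j == g1, tnth v2 j == g2 & tnth v3 j == g3]].

Definition QI_hedge : {set {set n.-tuple bool}} :=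
  [set e : {set n.-tuple bool} | (e \subset QI_vert) &&
     [exists v1, exists v2, exists v3,
        (e == [set v1; v2; v3]) && qualitatively_independent v1 v2 v3]].

Fact QI_hedge_vert e : e \in QI_hedge -> e \subset QI_vert.
Proof. by rewrite inE => /andP[]. Qed.

Fact QI_hedge_card e : e \in QI_hedge -> #|e| = 3.
Proof.
rewrite inE => /andP[_ /existsP[v1 /existsP[v2 /existsP[v3]]]].
case/andP=> /eqP-> qi.
have sep g1 g2 g3 : exists j : 'I_n,
    [&& tnth v1 j == g1, tnth v2 j == g2 & tnth v3 j == g3].
  by move/forallP/(_ g1)/forallP/(_ g2)/forallP/(_ g3)/existsP: qi.
have n12 : v1 != v2.
  by apply/eqP=> E; have [j] := sep true false true; rewrite E; case: (tnth v2 j).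
have n13 : v1 != v3.
  apply/eqP=> E; have [j] := sep true true false; rewrite E.
  by case: (tnth v3 j); rewrite ?andbF.
have n23 : v2 != v3.
  apply/eqP=> E; have [j] := sep true true false; rewrite E.
  by case: (tnth v3 j); rewrite ?andbF.
by rewrite -setUA cardsU1 cards2 !inE negb_or n12 n13 n23.
Qed.

Definition QI : hypergraph3 (n.-tuple bool) :=
  Hypergraph3 QI_hedge_vert QI_hedge_card.

(* Meant for n odd, so that n.-1./2 = (n-1)/2 and n.+1./2 = (n+1)/2. *)
Definition almost_uniform : {set n.-tuple bool} :=
  [set v : n.-tuple bool | [exists b : bool,
     (count_mem b v == n.-1./2) && (count_mem (~~ b) v == n.+1./2)]].

Definition AUQI : hypergraph3 (n.-tuple bool) := induced QI almost_uniform.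

Definition part v (b : bool) : {set 'I_n} := [set j | tnth v j == b].

(* The part of size (n-1)/2 of the partition of a vertex v of AUQI. *)
Definition small_part v : {set 'I_n} :=
  if #|part v false| == n.-1./2 then part v false else part v true.
End QualitativeIndependence.

(* Main.v *)
Require Import Defs.
From mathcomp Require Import all_boot.
From mathcomp Require Import zify.

(** Two vertices of the hypergraph cut the ground set into four cells.  A third
    partition completes them to a hyperedge exactly when it splits each of the
    four cells into two nonempty pieces, so two vertices with a common
    hyperedge have all four cells of size at least 2.  Conversely, let all
    cells have size at least 2 and put n = 2m + 1.  Choose two distinct points
    in every cell: a set containing the four first points and avoiding the four
    second points splits every cell, and such a set of size m exists because
    4 <= m <= n - 4.  This is [two_section_AUQI_adjE].

    If the small parts A and B, both of size m, meet in k points, then the four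
    cells have sizes k, m - k, m - k and k + 1, so all of them have size at
    least 2 if and only if 2 <= k <= m - 2 ([cells_gt1E]).

    The identification of vertices with m-sets is bijective because the first
    entry of a vertex is 0: a set M determines the partition {M, ~: M}, and the
    string is recovered by giving 0 to the part that contains the first
    position ([vertex_of]).

    The length of strings is written n.+1 with n even, so that m = n./2 and the
    first position is ord0. *)

Set Implicit Arguments.
Unset Strict Implicit.
Unset Printing Implicit Defensive.

(** * Cells and hyperedges *)

Section Parts.
Variable n : nat.
Implicit Types (u v w : n.-tuple bool) (a b c : bool).

Lemma in_part v b j : (j \in part v b) = (tnth v j == b).
Proof. by rewrite inE. Qed.

Lemma part_negb v b : part v (~~ b) = ~: part v b.
Proof. by apply/setP=> j; rewrite !inE; case: b; case: (tnth v j). Qed.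

Lemma card_part v b : #|part v b| = count_mem b v.
Proof.
rewrite -[in RHS](map_tnth_enum v) count_map -size_filter cardE.
by congr size; rewrite {1}/enum_mem enumT; apply: eq_filter => j; exact: in_part.
Qed.

Lemma card_part_negb v b : #|part v b| + #|part v (~~ b)| = n.
Proof. by rewrite part_negb cardsC card_ord. Qed.

Definition cell u v a b : {set 'I_n} := part u a :&: part v b.

Lemma in_cell u v a b j :
  (j \in cell u v a b) = (tnth u j == a) && (tnth v j == b).
Proof. by rewrite in_setI !in_part. Qed.

Lemma qualitatively_independentP u v w :
  reflect (forall a b c, exists2 j, j \in cell u v a b & tnth w j = c)
          (qualitatively_independent u v w).
Proof.
apply: (iffP idP) => [qi a b c | qi].
  move/forallP/(_ a)/forallP/(_ b)/forallP/(_ c)/existsP: qi => [j].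
  by case/and3P=> ja jb /eqP jc; exists j; rewrite ?in_cell ?ja.
apply/forallP=> a; apply/forallP=> b; apply/forallP=> c; apply/existsP.
have [j] := qi a b c; rewrite in_cell => /andP[ja jb] jc.
by exists j; rewrite ja jb jc eqxx.
Qed.

Lemma qualitatively_independent_swap u v w :
  qualitatively_independent u v w -> qualitatively_independent v u w.
Proof.
move/qualitatively_independentP=> qi; apply/qualitatively_independentP=> a b c.
by have [j] := qi b a c; rewrite in_cell andbC -in_cell; exists j.
Qed.

Lemma qualitatively_independent_rot u v w :
  qualitatively_independent u v w -> qualitatively_independent v w u.
Proof.
move/qualitatively_independentP=> qi; apply/qualitatively_independentP=> a b c.
have [j] := qi c a b; rewrite in_cell => /andP[/eqP ja jb] jc.
by exists j; rewrite ?in_cell ?jb ?jc /=.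
Qed.

(** Both values of w occur on each cell, at two different positions. *)
Lemma qualitatively_independent_cell u v w a b :
  qualitatively_independent u v w -> 1 < #|cell u v a b|.
Proof.
move/qualitatively_independentP=> qi; apply/card_gt1P.
have [i iab wi] := qi a b true; have [j jab wj] := qi a b false.
by exists i, j; split=> //; apply: contra_eq_neq wi => ->; rewrite wj.
Qed.

Lemma hyperedge_pair e u v :
  e \in QI_hedge n -> u \in e -> v \in e -> u != v ->
  exists w, qualitatively_independent u v w.
Proof.
rewrite inE => /andP[_ /existsP[v1 /existsP[v2 /existsP[v3 /andP[/eqP-> qi]]]]].
have rot := qualitatively_independent_rot.
have swap := qualitatively_independent_swap.
rewrite !inE -!orbA => /or3P[]/eqP-> /or3P[]/eqP->; rewrite ?eqxx // => _.
- by exists v3.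
- by exists v2; exact/swap/rot/rot.
- by exists v3; exact: swap.
- by exists v1; exact: rot.
- by exists v2; exact/rot/rot.
- by exists v1; exact/swap/rot.
Qed.

End Parts.

(** * Splitting all four cells *)

Lemma set_between_card (T : finType) (A B : {set T}) m :
  A \subset B -> #|A| <= m <= #|B| ->
  exists C : {set T}, [/\ A \subset C, C \subset B & #|C| = m].
Proof.
move=> sAB /andP[leAm lemB].
have /card_geqP[s [s_uniq s_size s_sub]] : m - #|A| <= #|B :\: A|.
  by rewrite cardsD (setIidPr sAB) leq_sub2r.
have sDA : [disjoint A & [set x in s]].
  rewrite disjoint_sym disjoint_subset; apply/subsetP=> x; rewrite !inE.
  by move/s_sub; rewrite !inE => /andP[].
exists (A :|: [set x in s]); split; first exact: subsetUl.
- rewrite subUset sAB; apply/subsetP=> x; rewrite inE => /s_sub.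
  by rewrite inE => /andP[].
- rewrite cardsU disjoint_setI0 // cards0 subn0 cardsE (card_uniqP s_uniq).
  by rewrite s_size subnKC.
Qed.

(** The set picks up one chosen point of each cell and misses another one;
    the chosen points number four each, which is where the bounds on m come
    from. *)
Lemma splitting_set n (u v : n.-tuple bool) m :
    (forall a b, 1 < #|cell u v a b|) -> 4 <= m -> m + 4 <= n ->
  exists2 C : {set 'I_n}, #|C| = m
    & forall a b c, exists2 j, j \in cell u v a b & (j \in C) = c.
Proof.
move=> cell_gt1 m_ge4 m_le.
have /fin_all_exists[f fP] (p : bool * bool) : exists xy : 'I_n * 'I_n,
    [/\ xy.1 \in cell u v p.1 p.2, xy.2 \in cell u v p.1 p.2 & xy.1 != xy.2].
  by have /card_gt1P[x [y [xp yp xy]]] := cell_gt1 p.1 p.2; exists (x, y).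
pose ins := [set (f p).1 | p : bool * bool].
pose out := [set (f p).2 | p : bool * bool].
have card_le4 (h : bool * bool -> 'I_n) : #|[set h p | p : bool * bool]| <= 4.
  by apply: leq_trans (leq_imset_card _ _) _; rewrite card_prod card_bool.
have ins_out : ins \subset ~: out.
  apply/subsetP=> _ /imsetP[p _ ->]; rewrite inE; apply/imsetP=> -[q _ pq].
  (* A common point would lie in the cells of p and of q, which then agree. *)
  have [p1 _ /eqP p12] := fP p; have [_ q2 _] := fP q.
  have pE : p = q.
    move: p1 q2; rewrite -pq !in_cell => /andP[/eqP-> /eqP->].
    by case: p q {pq p12} => [? ?] [? ?] /= /andP[/eqP-> /eqP->].
  by apply: p12; rewrite {2}pE.
have card_out : #|out| + #|~: out| = n by rewrite cardsC card_ord.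
have [|C [insC Cout cardC]] := set_between_card (m := m) ins_out.
  have := card_le4 (fun p => (f p).1); have := card_le4 (fun p => (f p).2).
  by rewrite -/ins -/out; lia.
have ins_in p : (f p).1 \in C by apply/(subsetP insC)/imset_f.
have out_notin p : (f p).2 \notin C.
  have out_p : (f p).2 \in out by apply/imset_f.
  by apply: contraL out_p => /(subsetP Cout); rewrite inE.
exists C => // a b c; have [f1 f2 _] := fP (a, b).
case: c; [exists (f (a, b)).1 => // | exists (f (a, b)).2 => //].
  exact: ins_in.
exact/negbTE/out_notin.
Qed.

(** * Vertices as m-sets *)

Section OddLength.
Variable n : nat.
Hypothesis n_even : ~~ odd n.
Implicit Types (u v : n.+1.-tuple bool) (M : {set 'I_n.+1}).

(** Of the two strings with parts M and ~: M, the one that starts with 0. *)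
Definition vertex_of M : n.+1.-tuple bool :=
  [tuple (i \in M) (+) (ord0 \in M) | i < n.+1].

Lemma part_vertex_of M : part (vertex_of M) (ord0 \notin M) = M.
Proof.
by apply/setP=> j; rewrite in_part tnth_mktuple; do 2!case: (_ \in M).
Qed.

(** As n.+1 is odd, the two parts have different sizes, so the small one is
    unique. *)
Lemma small_partE v b : #|part v b| = n./2 -> small_part v = part v b.
Proof.
move=> vb; rewrite /small_part /=; case: b vb => vb; last by rewrite vb eqxx.
by case: eqP => // v_false; have := card_part_negb v true; rewrite /= vb; lia.
Qed.

Lemma small_part_vertex_of M : #|M| = n./2 -> small_part (vertex_of M) = M.
Proof.
by move=> cardM; rewrite (@small_partE _ (ord0 \notin M)) part_vertex_of.
Qed.

Section Vertices.
Hypothesis n_ge8 : 8 <= n.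

(** The condition that each symbol occurs at least 4 times is absorbed by
    n >= 8, which gives n./2 >= 4. *)
Lemma AUQI_vertE v :
  (v \in hvert (AUQI n.+1)) =
  ~~ tnth v ord0 && [exists b, #|part v b| == n./2].
Proof.
have head_v : head false v = tnth v ord0 by rewrite (tnth_nth false) nth0.
rewrite !inE head_v eqbF_neg; case: (tnth v ord0) => //=.
apply/andP/existsP=> [[_ /existsP[b /andP[vb _]]]|[b /eqP vb]].
  by exists b; rewrite card_part.
have card_v := card_part_negb v b; rewrite vb in card_v.
have card_negb : #|part v (~~ b)| = n./2.+1 by lia.
split; last by apply/existsP; exists b; rewrite -!card_part vb card_negb !eqxx.
apply/forallP=> c; rewrite -card_part.
have /orP[/eqP-> | /eqP->] : (c == b) || (c == ~~ b) by case: c; case: (b).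
  by rewrite vb; lia.
by rewrite card_negb; lia.
Qed.

(** A vertex starts with 0, so the value of its small part is read off from
    whether that part contains the first position. *)
Lemma small_part_vert v : v \in hvert (AUQI n.+1) ->
  small_part v = part v (ord0 \notin small_part v) /\ #|small_part v| = n./2.
Proof.
rewrite AUQI_vertE => /andP[v0 /existsP[b /eqP vb]].
rewrite (small_partE vb) in_part (negPf v0) vb; split=> //.
by case: b {vb}.
Qed.

Lemma small_partK : {in hvert (AUQI n.+1), cancel (@small_part n.+1) vertex_of}.
Proof.
move=> v v_vert; have [vE _] := small_part_vert v_vert.
apply: eq_from_tnth => j; rewrite tnth_mktuple {1}vE in_part.
by case: (tnth v j); case: (ord0 \in _).
Qed.

Lemma vertex_of_vert M : #|M| = n./2 -> vertex_of M \in hvert (AUQI n.+1).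
Proof.
move=> cardM; rewrite AUQI_vertE tnth_mktuple addbb.
by apply/existsP; exists (ord0 \notin M); rewrite part_vertex_of cardM.
Qed.

Lemma two_section_AUQI_adjE :
  {in hvert (AUQI n.+1) &, forall u v,
    two_section_adj (AUQI n.+1) u v
      = [forall a, forall b, 1 < #|cell u v a b|]}.
Proof.
move=> u v u_vert v_vert; apply/andP/idP=> [[uv]|cells].
  case/exists_inP=> e; rewrite inE => /andP[e_hedge _] /andP[ue ve].
  have [w qi] := hyperedge_pair e_hedge ue ve uv.
  by do 2!apply/forallP=> ?; exact: qualitatively_independent_cell qi.
have cell_gt1 a b : 1 < #|cell u v a b| by move/forallP/(_ a)/forallP: cells.
split.
  have /card_gt1P[j [_ [+ _ _]]] := cell_gt1 true false.
  by rewrite in_cell; apply: contraTneq => ->; case: (tnth v j).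
have [||C cardC splitC] := splitting_set (m := n./2) cell_gt1; try lia.
have w_vert := vertex_of_vert cardC.
have e_vert : [set u; v; vertex_of C] \subset hvert (AUQI n.+1).
  by rewrite !subUset !sub1set u_vert v_vert.
apply/exists_inP; exists [set u; v; vertex_of C]; last first.
  by rewrite !inE !eqxx orbT.
rewrite inE e_vert andbT inE (subset_trans e_vert) ?subsetIl //=.
apply/existsP; exists u; apply/existsP; exists v; apply/existsP.
exists (vertex_of C); rewrite eqxx; apply/qualitatively_independentP=> a b c.
(* The string of C is its indicator function, complemented if ord0 \in C. *)
have [j jab jC] := splitC a b (c (+) (ord0 \in C)).
by exists j; rewrite ?tnth_mktuple ?jC ?addbK.
Qed.

End Vertices.

(** With k = #|part u a :&: part v b|, the other cells have sizes n./2 - k,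
    n./2 - k and k + 1; the last one is never the obstruction. *)
Lemma cells_gt1E u v a b :
    #|part u a| = n./2 -> #|part v b| = n./2 ->
  [forall a', forall b', 1 < #|cell u v a' b'|]
    = (2 <= #|part u a :&: part v b| <= n./2 - 2).
Proof.
move=> ua vb.
have -> : [forall a', forall b', 1 < #|cell u v a' b'|] =
    [&& 1 < #|cell u v a b|, 1 < #|cell u v a (~~ b)|,
        1 < #|cell u v (~~ a) b| & 1 < #|cell u v (~~ a) (~~ b)|].
  apply/forallP/and4P=> [cells | [c1 c2 c3 c4] a'].
    by split; apply: (forallP (cells _)).
  apply/forallP=> b'; move: c1 c2 c3 c4.
  by case: a {ua}; case: b {vb}; case: a'; case: b'.
have cell_row a' : #|cell u v a' b| + #|cell u v a' (~~ b)| = #|part u a'|.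
  by rewrite /cell part_negb -setDE cardsID.
have cell_col : #|cell u v a b| + #|cell u v (~~ a) b| = #|part v b|.
  by rewrite /cell part_negb setIC [_ :&: part v b]setIC -setDE cardsID.
have := cell_row a; have := cell_row (~~ a); have := card_part_negb u a.
rewrite -/(cell u v a b); lia.
Qed.

End OddLength.

Theorem lemma7 (n : nat) (n_ge9 : 9 <= n) (n_odd : odd n) :
  equal_via (@small_part n) (two_section (AUQI n))
    (merged_johnson n n.-1./2 [pred k | 2 <= k <= n.-1./2 - 2]).
Proof.
case: n n_ge9 n_odd => // n n_ge8 /= n_even.
split.
- exact: can_in_inj (small_partK n_even n_ge8).
- apply/setP=> M; rewrite [RHS]inE; apply/imsetP/eqP=> [[v v_vert ->]|cardM].
    by have [] := small_part_vert n_even n_ge8 v_vert.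
  by exists (vertex_of M); rewrite ?vertex_of_vert ?small_part_vertex_of.
- move=> u v u_vert v_vert; rewrite [LHS]two_section_AUQI_adjE //=.
  have [] := small_part_vert n_even n_ge8 u_vert.
  have [] := small_part_vert n_even n_ge8 v_vert.
  move: (ord0 \notin _) (ord0 \notin _) => b a vE cardv uE cardu.
  rewrite /merged_johnson_adj cardu cardv !eqxx uE vE.
  by apply: cells_gt1E; rewrite -?uE -?vE.
Qed.
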